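(* If the sequence classes $X_1,\ldots,X_n$ are jointly dominated, then the ideal $\Pi_{X_1,\ldots,X_n;Y}$ is symmetric for every finitely determined sequence class $Y$.
   Context: Banach spaces are over $\mathbb{K}=\mathbb{R}$ or $\mathbb{C}$; $\mathcal{L}(E_1,\ldots,E_n;F)$ is the space of continuous $n$-linear operators. $c_{00}(E)$ and $\ell_\infty(E)$ are the spaces of eventually null and of bounded $E$-valued sequences (the latter with the sup norm). $E\stackrel{1}{\hookrightarrow}F$ means that $E$ is a linear subspace of $F$ and $\|\cdot\|_F\le\|\cdot\|_E$ on $E$; for sequence classes, $X\stackrel{1}{\hookrightarrow}Y$ means $X(E)\stackrel{1}{\hookrightarrow}Y(E)$ for every Banach space $E$. $(x_j)_{j=1}^k$ also denotes the sequence $(x_1,\ldots,x_k,0,0,\ldots)$. Sequence class: a rule $X$ assigning to each Banach space $E$ a Banach space $X(E)$ of $E$-valued sequences such that $c_{00}(E)\subseteq X(E)\stackrel{1}{\hookrightarrow}\ell_\infty(E)$ and $\|e_j\|_{X(\mathbb{K})}=1$ for every $j\in\mathbb{N}$, where $e_j$ is the $j$-th canonical unit scalar sequence. Given sequence classes $X_1,\ldots,X_n,Y$, an operator $A\in\mathcal{L}(E_1,\ldots,E_n;F)$ is $(X_1,\ldots,X_n;Y)$-summing, written $A\in\Pi_{X_1,\ldots,X_n;Y}(E_1,\ldots,E_n;F)$, if $(A(x_j^1,\ldots,x_j^n))_{j=1}^\infty\in Y(F)$ whenever $(x_j^k)_{j=1}^\infty\in X_k(E_k)$, $k=1,\ldots,n$.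 Its norm is the norm of the induced continuous $n$-linear operator $X_1(E_1)\times\cdots\times X_n(E_n)\to Y(F)$. Standing assumptions: every sequence class $X$ is linearly stable, i.e. $\Pi_{X;X}(E;F)=\mathcal{L}(E;F)$ with equal norms for all Banach spaces $E,F$; and whenever $\Pi_{X_1,\ldots,X_n;Y}$ is considered, it is assumed that $(\lambda_j^1\cdots\lambda_j^n)_{j}\in Y(\mathbb{K})$ and $\|(\lambda_j^1\cdots\lambda_j^n)_{j}\|_{Y(\mathbb{K})}\le\prod_{k=1}^n\|(\lambda_j^k)_{j}\|_{X_k(\mathbb{K})}$ for all $(\lambda_j^k)_{j}\in X_k(\mathbb{K})$, $k=1,\ldots,n$ (so that $\Pi_{X_1,\ldots,X_n;Y}$ is a Banach ideal of $n$-linear operators). $\Pi_{X_1,\ldots,X_n;Y}$ is symmetric if, for all Banach spaces $E,F$ and every $A\in\Pi_{X_1,\ldots,X_n;Y}(E,\ldots,E;F)$, the symmetrization $A_s(x_1,\ldots,x_n)=\frac1{n!}\sum_{\sigma\in S_n}A(x_{\sigma(1)},\ldots,x_{\sigma(n)})$ belongs to $\Pi_{X_1,\ldots,X_n;Y}(E,\ldots,E;F)$. $X$ is finitely determined if, for every Banach space $E$ and every $(x_j)_{j=1}^\infty\in E^{\mathbb{N}}$, $(x_j)_{j=1}^\infty\in X(E)$ if and only if $\sup_k\|(x_j)_{j=1}^k\|_{X(E)}<\infty$, and in this case $\|(x_j)_{j=1}^\infty\|_{X(E)}=\sup_k\|(x_j)_{j=1}^k\|_{X(E)}$. For sequence classes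 $X,Y$, $X\stackrel{\rm fin}{\le}Y$ means that, for every Banach space $E$, $\|\cdot\|_{X(E)}\le\|\cdot\|_{Y(E)}$ on $c_{00}(E)$. The sequence classes $X_1,\ldots,X_n$ are jointly dominated if there exists a finitely determined sequence class $X$ such that $X_i\stackrel{1}{\hookrightarrow}X$ and $X_i\stackrel{\rm fin}{\le}X$ for $i=1,\ldots,n$. *)

(* Defs.v *)
From HB Require Import structures.
From mathcomp Require Import all_boot all_order all_algebra perm.
From mathcomp Require Import boolp classical_sets functions reals.
From mathcomp Require Import topology normedtype.
From mathcomp Require Import complex.

Set Implicit Arguments.
Unset Strict Implicit.
Unset Printing Implicit Defensive.

Import Order.TTheory GRing.Theory Num.Theory.
Import numFieldNormedType.Exports.

Local Open Scope classical_set_scope.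
Local Open Scope ring_scope.

(* A Banach space over K is a [completeNormedModType K]. Library norms take
   their values in K; when K = R[i] they are nonnegative reals, and suprema
   are taken for the partial order of R[i]. *)

Record completeField := CompleteField {
  cfield :> numFieldType;
  cfield_complete : forall F : set_system cfield^o,
    ProperFilter F -> cauchy F -> cvg F }.

Definition banach_line (K : completeField) : completeNormedModType K :=
  HB.pack (K : numFieldType)^o
    (Uniform_isComplete.Build (K : numFieldType)^o (@cfield_complete K)).

Definition real_field (R : realType) : completeField :=
  @CompleteField R (@R_complete R).

Section complex_complete.
Variable R : realType.
Local Open Scope complex_scope.

Lemma normc_ge_Im (z : R[i]) : `|complex.Im z|%:C <= `|z|.
Proof.
by case: z => a b; simpc; rewrite -sqrtr_sqr ler_wsqrtr // lerDr sqr_ge0.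
Qed.

Lemma normc_le_ReIm (z : R[i]) : `|z| <= (`|complex.Re z| + `|complex.Im z|)%:C.
Proof.
case: z => a b; simpc => /=.
rewrite -(@ler_pXn2r _ 2) ?nnegrE ?sqrtr_ge0 ?addr_ge0 ?normr_ge0//.
rewrite sqr_sqrtr ?addr_ge0 ?sqr_ge0// sqrrD !real_normK ?num_real//.
by rewrite addrAC lerDl mulrn_wge0 // mulr_ge0.
Qed.

Lemma cvg_cauchy_part (f : R[i] -> R) (F : set_system R[i]^o) :
  {morph f : x y / x - y} -> (forall z, `|f z|%:C <= `|z|) ->
  ProperFilter F -> cauchy F -> cvg (f @ F).
Proof.
move=> fB fle FF /cauchy_ballP cF; apply: R_complete; apply/cauchy_ballP => e e0.
have e0C : 0 < e%:C by rewrite ltcR.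
have [[A B] /= [FA FB] AB] := cF _ e0C.
exists (f @` A, f @` B).
  by split=> /=; [apply: filterS FA | apply: filterS FB] => x ?; exists x.
move=> [_ _] /= [[x Ax <-] [y By <-]].
rewrite /ball/= -ltcR -fB; apply: le_lt_trans (fle _) _.
exact: (AB (x, y)).
Qed.

Lemma ReB : {morph @complex.Re R : x y / x - y}. Proof. by move=> [? ?] []. Qed.
Lemma ImB : {morph @complex.Im R : x y / x - y}. Proof. by move=> [? ?] []. Qed.

Lemma C_complete (F : set_system R[i]^o) :
  ProperFilter F -> cauchy F -> cvg F.
Proof.
move=> FF cF; apply/cvg_ex.
have /cvg_ex[a Fa] := cvg_cauchy_part ReB (@normc_ge_Re R) FF cF.
have /cvg_ex[b Fb] := cvg_cauchy_part ImB normc_ge_Im FF cF.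
exists (a +i* b); apply/cvgrPdist_lt => e e0.
have [eR e0'] : e = (complex.Re e)%:C /\ 0 < complex.Re e.
  by move: e0; case: e => x y; rewrite ltcE => /andP[/eqP /= -> ->].
have he : 0 < complex.Re e / 2 by rewrite divr_gt0.
move/cvgrPdist_lt : Fa => /(_ _ he) Fa; move/cvgrPdist_lt : Fb => /(_ _ he) Fb.
near=> z; rewrite eR; apply: le_lt_trans (normc_le_ReIm _) _.
rewrite ltcR ReB ImB /= [ltRHS]splitr ltrD//; [near: z; exact: Fa|].
by near: z; exact: Fb.
Unshelve. all: by end_near. Qed.

End complex_complete.

Definition complex_field (R : realType) : completeField :=
  @CompleteField R[i] (@C_complete R).

Section sequence_spaces.
Variables (K : numFieldType) (E : completeNormedModType K).

(* A Banach space of E-valued sequences: the library Banach space [carrier]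
   with a linear injection into E^nat reading off the coordinates. *)
Record seqSpace := SeqSpace {
  carrier :> completeNormedModType K;
  coords : {linear carrier -> (nat -> E)};
  coords_inj : injective coords }.

Definition seqs (S : seqSpace) : set (nat -> E) := range (coords S).

(* Norm of x in S; junk value 0 when x is not in [seqs S]. *)
Definition seqnorm (S : seqSpace) (x : nat -> E) : K :=
  `|xget 0 [set u | coords S u = x]|.

Definition c00 : set (nat -> E) := [set x | \forall j \near \oo, x j = 0].

Definition linfty : set (nat -> E) := bounded_fun.

Definition linfty_norm (x : nat -> E) : K :=
  supremum 0 (range (fun j => `|x j|)).

(* [trunc k x] keeps the first k terms of x. *)
Definition trunc (k : nat) (x : nat -> E) : nat -> E :=
  fun j => if (j < k)%N then x j else 0.

End sequence_spaces.

Arguments c00 {K} E.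
Arguments linfty {K} E.

(* Used for sets of sequences carrying the pointwise linear structure, so that
   inclusion is inclusion as a linear subspace. *)
Definition embed1 (K : numFieldType) (V : Type)
    (A : set V) (normA : V -> K) (B : set V) (normB : V -> K) : Prop :=
  A `<=` B /\ forall x, A x -> normB x <= normA x.

Definition unit_seq (K : completeField) (j : nat) : nat -> banach_line K :=
  fun i => (i == j)%:R : K.

Record seqClass (K : completeField) := SeqClass {
  seq_space :> forall E : completeNormedModType K, seqSpace E;
  seq_c00 : forall E, c00 E `<=` seqs (seq_space E);
  seq_linfty : forall E,
    embed1 (seqs (seq_space E)) (seqnorm (seq_space E))
           (linfty E) (@linfty_norm K E);
  seq_unit : forall j, seqnorm (seq_space (banach_line K)) (unit_seq K j) = 1 }.

Section multilinear.
Variables (K : numFieldType) (n : nat).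
Variables (E : 'I_n -> completeNormedModType K) (F : completeNormedModType K).

Definition multilinear (A : (forall k, E k) -> F) : Prop :=
  forall (k : 'I_n) (x : forall k, E k), linear (fun y : E k => A (dfwith x y)).

Definition continuous_multilinear : set ((forall k, E k) -> F) :=
  [set A | multilinear A /\ continuous (A : prod_topology E -> F)].

Definition multilinear_norm (A : (forall k, E k) -> F) : K :=
  supremum 0 [set `|A x| | x in [set x | forall k, `|x k| <= 1]].

End multilinear.

Arguments continuous_multilinear {K n} E F.

Section summing.
Variables (K : completeField) (n : nat) (X : 'I_n -> seqClass K).
Variable Y : seqClass K.

Section operators.
Variables (E : 'I_n -> completeNormedModType K) (F : completeNormedModType K).

Definition induced (A : (forall k, E k) -> F) (x : forall k, nat -> E k) :
  nat -> F := fun j => A (fun k => x k j).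

Definition summing : set ((forall k, E k) -> F) :=
  [set A | continuous_multilinear E F A /\
    forall x : forall k, nat -> E k,
      (forall k, seqs (X k (E k)) (x k)) -> seqs (Y F) (induced A x)].

Definition summing_norm (A : (forall k, E k) -> F) : K :=
  supremum 0 [set seqnorm (Y F) (induced A x) | x in
    [set x : forall k, nat -> E k |
      forall k, seqs (X k (E k)) (x k) /\ seqnorm (X k (E k)) (x k) <= 1]].

End operators.

Definition ideal_condition : Prop :=
  forall lam : 'I_n -> nat -> banach_line K,
    (forall k, seqs (X k (banach_line K)) (lam k)) ->
    let p : nat -> banach_line K := fun j => \prod_(k < n) (lam k j : K) in
    seqs (Y (banach_line K)) p /\
    seqnorm (Y (banach_line K)) p
      <= \prod_(k < n) seqnorm (X k (banach_line K)) (lam k).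

End summing.

Arguments summing {K n} X Y E F.

(* Linear operators are 1-linear operators, indexed by 'I_1. *)
Definition linearly_stable (K : completeField) (X : seqClass K) : Prop :=
  forall E F : completeNormedModType K,
    summing (fun _ : 'I_1 => X) X (fun=> E) F
      = continuous_multilinear (fun _ : 'I_1 => E) F /\
    forall A, continuous_multilinear (fun _ : 'I_1 => E) F A ->
      summing_norm (fun _ : 'I_1 => X) X A = multilinear_norm A.

Definition symmetrization (K : numFieldType) (n : nat)
    (E F : completeNormedModType K) (A : ('I_n -> E) -> F) : ('I_n -> E) -> F :=
  fun x => (n`!%:R : K)^-1 *: \sum_(s : 'S_n) A (fun k => x (s k)).

Definition symmetric_summing (K : completeField) (n : nat)
    (X : 'I_n -> seqClass K) (Y : seqClass K) : Prop :=
  forall (E F : completeNormedModType K) (A : ('I_n -> E) -> F),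
    summing X Y (fun=> E) F A -> summing X Y (fun=> E) F (symmetrization A).

Definition finitely_determined (K : completeField) (X : seqClass K) : Prop :=
  forall (E : completeNormedModType K) (x : nat -> E),
    let N := range (fun k => seqnorm (X E) (trunc k.+1 x)) in
    (seqs (X E) x <-> has_ubound N) /\
    (seqs (X E) x -> seqnorm (X E) x = supremum 0 N).

Definition seq_embed1 (K : completeField) (X Y : seqClass K) : Prop :=
  forall E : completeNormedModType K,
    embed1 (seqs (X E)) (seqnorm (X E)) (seqs (Y E)) (seqnorm (Y E)).

Definition fin_le (K : completeField) (X Y : seqClass K) : Prop :=
  forall (E : completeNormedModType K) (x : nat -> E),
    c00 E x -> seqnorm (X E) x <= seqnorm (Y E) x.

(* The dominating class is subject to the standing assumption that sequence
   classes are linearly stable. *)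
Definition jointly_dominated (K : completeField) (n : nat)
    (X : 'I_n -> seqClass K) : Prop :=
  exists Z : seqClass K,
    [/\ linearly_stable Z, finitely_determined Z,
        forall i, seq_embed1 (X i) Z & forall i, fin_le (X i) Z].

(* Main.v *)
Require Import Defs.
From mathcomp Require Import all_boot all_order all_algebra perm.
From mathcomp Require Import boolp classical_sets functions reals.
From mathcomp Require Import topology normedtype complex.

Set Implicit Arguments.
Unset Strict Implicit.
Unset Printing Implicit Defensive.

Import Order.TTheory GRing.Theory Num.Theory.
Import numFieldNormedType.Exports.

Local Open Scope classical_set_scope.
Local Open Scope ring_scope.

(** Fix a summing operator A and sequences x_k in X_k(E), and let s be a
    permutation. Each x_(s k) lies in X_(s k)(E), hence in Z(E) for the
    dominating class Z, so its truncations are bounded in Z(E); these are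
    eventually null sequences, on which the norm of X_k is at most the norm of
    Z, so they are bounded in X_k(E) as well, although x_(s k) itself may fail
    to belong to X_k(E). The theorem thus reduces to [summing_trunc_bounded]: a
    summing operator with values in a finitely determined class Y sends
    sequences whose truncations are merely bounded in the X_k(E_k) into Y(F).
    Applied to all s, this puts the symmetrization in Y(F), a linear space.

    One could derive that fact from the boundedness of the induced multilinear
    operator, that is, from the closed graph theorem. The proof given here is a
    direct condensation of singularities. Write a_j = A(x_j) and suppose that
    the norms t_m of the truncations of a are unbounded. Choose positive
    integers v_j increasing to infinity so slowly that (v_m - 1)^(n+1) is at
    most some t_j with j <= m ([slow_weight]). Summation by parts shows that
    dividing by v_j turns a sequence with bounded truncations into a member of
    X_k(E_k) ([seqs_divided]), so b_j = A(x_j / v_j) = a_j / v_j^n defines a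
    member of Y(F), whose truncations are therefore bounded, by B say. A second
    summation by parts gives t_m <= 2 v_m^n B ([trunc_weighted_le]), and
    comparing exponents n+1 and n bounds v, a contradiction.

    Summation by parts is what makes this work in classes where multiplication
    by a bounded scalar sequence need not be a bounded operator: only the
    truncations and the total variation of the weights are used. *)

(** * Spaces of sequences *)

Section seq_space.
Variables (K : numFieldType) (E : completeNormedModType K) (S : seqSpace E).

Lemma seqnorm_coords (u : S) : seqnorm S (coords S u) = `|u|.
Proof.
rewrite /seqnorm; congr `|_|; apply: (@coords_inj _ _ S).
have : exists v, coords S v = coords S u by exists u.
exact: (@xgetPex _ 0 [set v | coords S v = coords S u]).
Qed.

Lemma seqs0 : seqs S 0.
Proof. by exists 0 => //; exact: linear0. Qed.

Lemma seqsD x y : seqs S x -> seqs S y -> seqs S (x + y).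
Proof. by move=> [u _ <-] [v _ <-]; exists (u + v); rewrite ?linearD. Qed.

Lemma seqsZ c x : seqs S x -> seqs S (c *: x).
Proof. by move=> [u _ <-]; exists (c *: u); rewrite ?linearZ. Qed.

Lemma seqs_sum (I : Type) (r : seq I) (P : pred I) (f : I -> nat -> E) :
  (forall i, P i -> seqs S (f i)) -> seqs S (\sum_(i <- r | P i) f i).
Proof. by move=> Sf; elim/big_ind : _; [exact: seqs0|exact: seqsD|]. Qed.

Lemma seqnorm0 : seqnorm S 0 = 0.
Proof. by rewrite -(linear0 (coords S)) seqnorm_coords normr0. Qed.

Lemma trunc_nil (x : nat -> E) : trunc 0 x = 0.
Proof. by apply/funext => j. Qed.

Lemma c00_trunc m (x : nat -> E) : c00 E (trunc m x).
Proof. by exists m => // j /= mj; rewrite /trunc ltnNge mj. Qed.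

(** In terms of the truncations u_m of x, multiplying x by a weight w is the
    sum of the w_j (u_(j+1) - u_j); this puts weighted truncations in the form
    to which summation by parts applies. *)
Lemma coords_weighted_sum (w : nat -> K) (x : nat -> E) (u : nat -> S) M :
  (forall m, coords S (u m) = trunc m x) ->
  coords S (\sum_(0 <= j < M) w j *: (u j.+1 - u j)) =
  trunc M (fun j => w j *: x j).
Proof.
move=> uE; elim: M => [|M IH]; first by rewrite big_nil linear0 trunc_nil.
rewrite big_nat_recr//= linearD IH linearZ linearB !uE; apply/funext => i.
rewrite -[LHS]/(_ + w M *: (trunc M.+1 x i - trunc M x i)) /trunc ltnS.
case: ltngtP => [_|_|->].
- by rewrite subrr scaler0 addr0.
- by rewrite subrr scaler0 addr0.
- by rewrite subr0 add0r.
Qed.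

End seq_space.

(** * Real and complex scalars *)

Lemma ge0_complexE (R : realType) (x : R[i]) :
  0 <= x -> x = ((complex.Re x)%:C)%C.
Proof. by case: x => a b; rewrite lecE /= => /andP[/eqP -> _]. Qed.

Section scalars.
Variables (R : realType) (K : completeField).
Hypothesis K_R_or_C : K = real_field R \/ K = complex_field R.

Lemma scalar_le_nat (x : K) : 0 <= x -> exists N : nat, x <= N%:R.
Proof.
case: K_R_or_C x => -> /= x x0.
  by exists (Num.bound x); exact/ltW/archi_boundP.
have re0 : 0 <= complex.Re x by move: x0; rewrite lecE => /andP[].
exists (Num.bound (complex.Re x)).
rewrite (ge0_complexE x0) -(rmorph_nat (real_complex R)) lecR.
exact/ltW/archi_boundP.
Qed.

(** In the partially ordered field of complex numbers a bounded set of
    nonnegative elements lies on the real axis, so its supremum is that of the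
    real parts; an arbitrary upper bound is itself a nonnegative real. *)
Lemma scalar_supremum_exists (A : set K) : A !=set0 -> has_ubound A ->
  (forall x, A x -> 0 <= x) -> exists s, supremums A s.
Proof.
case: K_R_or_C A => -> /= A A0 uA nnA.
  exists (sup A : R); split => [x Ax|x ux]; last exact: ge_sup.
  exact: (@sup_upper_bound R A (conj A0 uA)).
have posA x : A x -> x = ((complex.Re x)%:C)%C.
  by move=> /nnA; exact: ge0_complexE.
have [M uM] := uA; have [x0 Ax0] := A0.
have uRe (N : R[i]) : ubound A N -> ubound (@complex.Re R @` A) (complex.Re N).
  move=> uN _ [x Ax <-]; have := uN _ Ax; rewrite {1}(posA _ Ax).
  by case: {uN} N => a b; rewrite lecE /= => /andP[].
have supRe : has_sup (@complex.Re R @` A).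
  by split; [exists (complex.Re x0), x0 | exists (complex.Re M); exact: uRe].
exists ((sup (@complex.Re R @` A))%:C)%C; split => [x Ax|N uN].
  by rewrite (posA _ Ax) lecR; apply: (sup_upper_bound supRe); exists x.
have N0 : 0 <= N by apply: le_trans (nnA _ Ax0) (uN _ Ax0).
rewrite (ge0_complexE N0) lecR; apply: ge_sup; last exact: uRe.
exact: supRe.1.
Qed.

Lemma le_supremum (A : set K) x : has_ubound A -> (forall y, A y -> 0 <= y) ->
  A x -> x <= supremum 0 A.
Proof.
move=> uA nnA Ax; have A0 : A !=set0 by exists x.
rewrite /supremum; case: ifPn => [/eqP A_eq0|_]; first by rewrite A_eq0 in Ax.
by have [ub _] := xgetPex 0 (scalar_supremum_exists A0 uA nnA); exact: ub.
Qed.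

(** The embedding of X(E) in the bounded sequences makes the coordinates
    continuous: limits in X(E) are computed coordinatewise. *)
Lemma norm_coords_le (X : seqClass K) (E : completeNormedModType K)
    (u : X E) j :
  `|coords (X E) u j| <= `|u|.
Proof.
have [Xinf Xle] := @seq_linfty K X E.
have Xu : seqs (X E) (coords (X E) u) by exists u.
rewrite -seqnorm_coords; apply: le_trans (Xle _ Xu); apply: le_supremum.
- have /filter_ex[M bM] : \forall M \near +oo,
      globally setT [set i | `|coords (X E) u i| <= M] := Xinf _ Xu.
  by exists M => _ [i _ <-]; exact: bM.
- by move=> _ [i _ <-].
- by exists j.
Qed.

End scalars.

(** * Slowly increasing weights *)

(** Any unbounded t dominates, up to time m, the power p of an integer weight
    that still tends to infinity: take the largest k <= m for which k^p has
    been reached by t. The shift by one keeps the weight positive, and the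
    truncation k <= m makes the maximum finite. *)
Lemma slow_weight (K : numFieldType) (t : nat -> K) (p : nat) : (0 < p)%N ->
  (forall m, 0 <= t m) -> ~ (exists C, forall m, t m <= C) ->
  exists v : nat -> nat,
    [/\ {homo v : i j / (i <= j)%N}, forall N, exists m, (N <= v m)%N &
        forall m, (0 < v m)%N /\
          exists2 j, (j <= m)%N & (v m).-1%:R ^+ p <= t j].
Proof.
move=> p0 t0 tunb.
have large N : exists j, N%:R ^+ p <= t j.
  apply: contra_notP tunb => /forallNP small; exists (N%:R ^+ p) => m.
  have := small m => /negP.
  by rewrite -real_ltNge ?ger0_real ?exprn_ge0 ?ler0n// => /ltW.
pose P m (k : nat) := `[< exists2 j, (j <= m)%N & k%:R ^+ p <= t j >].
exists (fun m => (\max_(k < m.+1 | P m k) k).+1); split.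
- move=> i j ij; rewrite ltnS; apply/bigmax_leqP => k /asboolP[l li kl].
  have kj : (k < j.+1)%N by rewrite (leq_trans (ltn_ord k)).
  apply: (@leq_bigmax_cond _ (fun k : 'I_j.+1 => P j k) val (Ordinal kj)).
  by apply/asboolP; exists l => //; exact: leq_trans ij.
- move=> N; have [j Nj] := large N; exists (maxn j N); apply: leqW.
  have kj : (N < (maxn j N).+1)%N by rewrite ltnS leq_maxr.
  apply: (@leq_bigmax_cond _ (fun k : 'I__ => P (maxn j N) k) val (Ordinal kj)).
  by apply/asboolP; exists j => //; rewrite leq_maxl.
- move=> m; split => //=.
  have /(eq_bigmax_cond (val : 'I_m.+1 -> nat)) :
      (0 < #|(fun k : 'I_m.+1 => P m k) : pred 'I_m.+1|)%N.
    apply/card_gt0P; exists ord0; apply/asboolP; exists 0%N => //.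
    by rewrite expr0n eqn0Ngt p0.
  by case=> k /asboolP[j jm kj] ->; exists j.
Qed.

(** * Summation by parts *)

Section abel.
Variables (K : numFieldType) (V : normedModType K).

Lemma abel_summation (w : nat -> K) (u : nat -> V) m M : (m <= M)%N ->
  \sum_(m <= j < M) w j *: (u j.+1 - u j) =
  w M *: u M - w m *: u m - \sum_(m <= j < M) (w j.+1 - w j) *: u j.+1.
Proof.
move=> mM; rewrite -(@telescope_sumr _ m M (fun j => w j *: u j))//.
rewrite -sumrB; apply: eq_bigr => j _.
by rewrite scalerBr scalerBl opprB [RHS]addrC addrA subrK.
Qed.

Lemma abel_bound (w : nat -> K) (u : nat -> V) C m M : (m <= M)%N ->
  (forall j, `|u j| <= C) ->
  `|\sum_(m <= j < M) w j *: (u j.+1 - u j)| <=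
  (`|w M| + `|w m| + \sum_(m <= j < M) `|w j.+1 - w j|) * C.
Proof.
move=> mM uC; rewrite abel_summation// (le_trans (ler_normB _ _))//.
rewrite mulrDl mulrDl lerD//.
  by rewrite (le_trans (ler_normB _ _))// !normrZ lerD// ler_wpM2l.
rewrite (le_trans (ler_norm_sum _ _ _))// mulr_suml ler_sum// => j _.
by rewrite normrZ ler_wpM2l.
Qed.

Lemma abel_bound_nonincr (w : nat -> K) (u : nat -> V) C m M : (m <= M)%N ->
  (forall j, `|u j| <= C) -> (forall j, 0 <= w j) ->
  (forall j, w j.+1 <= w j) ->
  `|\sum_(m <= j < M) w j *: (u j.+1 - u j)| <= 2 * w m * C.
Proof.
move=> mM uC w0 wD; rewrite (le_trans (abel_bound _ mM uC))//.
under eq_bigr => j _ do rewrite distrC ger0_norm ?subr_ge0// -opprB.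
rewrite sumrN telescope_sumr// !ger0_norm// opprB.
by rewrite addrC addrA subrK mulr_natl.
Qed.

Lemma abel_bound_nondecr (w : nat -> K) (u : nat -> V) C M :
  (forall j, `|u j| <= C) -> (forall j, 0 <= w j) ->
  (forall j, w j <= w j.+1) ->
  `|\sum_(0 <= j < M) w j *: (u j.+1 - u j)| <= 2 * w M * C.
Proof.
move=> uC w0 wI; rewrite (le_trans (abel_bound _ (leq0n M) uC))//.
under eq_bigr => j _ do rewrite ger0_norm ?subr_ge0//.
rewrite telescope_sumr// !ger0_norm//.
by rewrite addrACA subrr addr0 mulr_natl.
Qed.

End abel.

(** * Multilinear maps and symmetrization *)

Lemma continuous_prod_topology (I : Type) (T : topologicalType)
    (U : I -> topologicalType) (g : T -> prod_topology U) :
  (forall i, continuous (fun x => g x i)) -> continuous g.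
Proof.
move=> gc x; apply/cvg_sup => i V [B] [[W oW <-]] /= Wx /filterS; apply.
by apply: (gc i x); exact: open_nbhs_nbhs.
Qed.

Lemma continuous_scale_sum (K : numFieldType) (T : topologicalType)
    (F : normedModType K) (I : Type) (r : seq I) (f : I -> T -> F) (c : K) :
  (forall i, continuous (f i)) ->
  continuous (fun x => c *: \sum_(i <- r) f i x).
Proof.
move=> fc x; apply: cvgZl_tmp; elim: r => [|i r IH].
  by under eq_fun do rewrite big_nil; rewrite big_nil; exact: cvg_cst.
under eq_fun do rewrite big_cons; rewrite big_cons.
by apply: cvgD => //; exact: fc.
Qed.

Section multilinear_maps.
Variables (K : numFieldType) (n : nat).

Lemma multilinear_scale (E : 'I_n -> completeNormedModType K)
    (F : completeNormedModType K) (A : (forall k, E k) -> F) (c : K)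
    (x : forall k, E k) :
  multilinear A -> A (fun k => c *: x k) = c ^+ n *: A x.
Proof.
move=> Alin.
(* Scale the coordinates one at a time: f m has the first m of them scaled. *)
pose f m : forall k, E k := fun k => if (k < m)%N then c *: x k else x k.
have Af m : (m <= n)%N -> A (f m) = c ^+ m *: A x.
  elim: m => [_|m IH mn].
    by rewrite expr0 scale1r; congr A; apply: functional_extensionality_dep.
  pose k0 := Ordinal mn; pose g y := A (dfwith (f m) (i := k0) y).
  have g_lin a y z : g (a *: y + z) = a *: g y + g z by exact: Alin.
  have g0 : g 0 = 0.
    by have := g_lin (-1) 0 0; rewrite scaler0 addr0 scaleN1r addNr.
  have gZ y : g (c *: y) = c *: g y.
    by have := g_lin c y 0; rewrite g0 !addr0.
  have fS : f m.+1 = dfwith (f m) (i := k0) (c *: x k0).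
    apply: functional_extensionality_dep => i.
    case: dfwithP => [|k]; rewrite /f /=; first by rewrite ltnSn.
    by rewrite -val_eqE /= ltnS leq_eqVlt eq_sym => /negPf ->.
  have fm : f m = dfwith (f m) (i := k0) (x k0).
    apply: functional_extensionality_dep => i.
    by case: dfwithP => [|//]; rewrite /f /= ltnn.
  by rewrite fS -/(g _) gZ {1}/g -fm IH ?(ltnW mn)// scalerA exprS.
rewrite -Af//; congr A; apply: functional_extensionality_dep => i.
by rewrite /f ltn_ord.
Qed.

Variables (E F : completeNormedModType K).

Lemma continuous_multilinear_perm (A : ('I_n -> E) -> F) (s : 'S_n) :
  continuous_multilinear (fun=> E) F A ->
  continuous_multilinear (fun=> E) F (fun x => A (fun k => x (s k))).
Proof.
move=> [Alin Acont]; split.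
- move=> k x a u v /=.
  have dfE w : (fun i => dfwith (T := fun=> E) x (i := k) w (s i)) =
      dfwith (T := fun=> E) (fun i => x (s i)) (i := (s^-1)%g k) w.
    apply/funext => i; have [<-|ki] := eqVneq (s i) k.
      by rewrite permK !dfwith_in.
    by rewrite !dfwith_out 1?eq_sym// -(inj_eq (@perm_inj _ s)) permKV.
  by rewrite !dfE Alin.
- pose g (x : prod_topology (fun _ : 'I_n => E)) :
    prod_topology (fun _ : 'I_n => E) := fun k => x (s k).
  suff gcont : continuous g.
    move=> x; apply: (@continuous_comp _ _ _ g A); first exact: gcont.
    exact: Acont.
  apply: continuous_prod_topology => i x.
  exact: (@proj_continuous _ (fun=> E) (s i) x).
Qed.

Lemma continuous_multilinear_sum (I : Type) (r : seq I)
    (A : I -> ('I_n -> E) -> F) c :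
  (forall i, continuous_multilinear (fun=> E) F (A i)) ->
  continuous_multilinear (fun=> E) F (fun x => c *: \sum_(i <- r) A i x).
Proof.
move=> AP; split.
- move=> k x a u v /=; rewrite scalerA [a * c]mulrC -scalerA -scalerDr.
  congr (_ *: _); rewrite scaler_sumr -big_split; apply: eq_bigr => i _.
  exact: (AP i).1.
- apply: (@continuous_scale_sum _ (prod_topology (fun _ : 'I_n => E))) => i.
  exact: (AP i).2.
Qed.

Lemma symmetrization_continuous_multilinear (A : ('I_n -> E) -> F) :
  continuous_multilinear (fun=> E) F A ->
  continuous_multilinear (fun=> E) F (symmetrization A).
Proof.
move=> AP; apply: continuous_multilinear_sum => s.
exact: continuous_multilinear_perm.
Qed.

End multilinear_maps.

(** * Weighted sequences in a sequence class *)

(** The empty truncation has norm 0, so a bound on the nonempty ones bounds it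
    as well; running over all lengths matches the indexing of summation by
    parts. *)
Lemma finitely_determinedP (K : completeField) (X : seqClass K)
    (E : completeNormedModType K) (x : nat -> E) : finitely_determined X ->
  seqs (X E) x <-> exists C, forall m, seqnorm (X E) (trunc m x) <= C.
Proof.
move=> /(_ E x)/= [-> _]; split=> [[C ubC]|[C ubC]]; exists C; last first.
  by move=> _ [m _ <-].
move=> m; case: m => [|m]; last by apply: ubC; exists m.
rewrite trunc_nil seqnorm0; apply: (@le_trans _ _ (seqnorm (X E) (trunc 1 x))).
  exact: normr_ge0.
by apply: ubC; exists 0%N.
Qed.

Section weights.
Variables (R : realType) (K : completeField).
Hypothesis K_R_or_C : K = real_field R \/ K = complex_field R.
Variables (X : seqClass K) (E : completeNormedModType K).

Lemma coords_trunc (x : nat -> E) :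
  exists u : nat -> X E, forall m, coords (X E) (u m) = trunc m x.
Proof.
have /choice[u uE] m : exists u : X E, coords (X E) u = trunc m x.
  by have [u _ <-] := @seq_c00 K X E _ (c00_trunc m x); exists u.
by exists u.
Qed.

(** The truncations of x / v form a Cauchy sequence in the Banach space X(E):
    by summation by parts, past the index m they vary by at most 2 C / v_m.
    Their limit has the right coordinates because each coordinate of the
    truncations is eventually constant. *)
Lemma seqs_divided (x : nat -> E) C (v : nat -> nat) :
  (forall m, seqnorm (X E) (trunc m x) <= C) ->
  (forall j, 0 < v j)%N -> {homo v : i j / (i <= j)%N} ->
  (forall N, exists m, (N <= v m)%N) ->
  seqs (X E) (fun j => (v j)%:R^-1 *: x j).
Proof.
move=> xC v0 vI vunb; have [u uE] := coords_trunc x.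
have uC m : `|u m| <= C by rewrite -seqnorm_coords uE.
pose w j : K := (v j)%:R^-1.
have w0 j : 0 <= w j by rewrite invr_ge0.
have wD j : w j.+1 <= w j.
  by rewrite lef_pV2 ?posrE ?ltr0n ?v0// ler_nat vI.
pose D M := \sum_(0 <= j < M) w j *: (u j.+1 - u j).
have DE M : coords (X E) (D M) = trunc M (fun j => w j *: x j).
  exact: coords_weighted_sum.
have C0 : 0 <= C by exact: le_trans (uC 0%N).
have Dcvg : cvg (D @ \oo).
  apply/cauchy_cvgP/cauchy_exP => e e0.
  have [|N NC] := @scalar_le_nat _ _ K_R_or_C (2 * C / e).
    by rewrite divr_ge0 ?mulr_ge0// ltW.
  have [m Nm] := vunb N.+1.
  exists (D m); exists m => // M /= mM.
  rewrite -ball_normE /= distrC /D (big_cat_nat (n := m))//= addrAC subrr add0r.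
  apply: le_lt_trans (abel_bound_nonincr mM uC w0 wD) _.
  rewrite mulrAC ltr_pdivrMr ?ltr0n ?v0// -ltr_pdivrMl// mulrC.
  by apply: le_lt_trans NC _; rewrite ltr_nat.
(* If the coordinate j of the limit were off by d <> 0, then all truncations
   longer than j would stay at distance at least |d| from the limit. *)
exists (lim (D @ \oo)) => //; apply/funext => j.
apply/eqP; rewrite -subr_eq0; apply: contraT => d_neq0.
set d := _ - _ in d_neq0; have d0 : 0 < `|d| by rewrite normr_gt0.
have /cvgrPdist_lt/(_ _ d0)[M _ near_lim] := Dcvg.
have lim_lt := near_lim (maxn M j.+1) (leq_maxl _ _).
suff /le_lt_trans/(_ lim_lt) : `|d| <= `|lim (D @ \oo) - D (maxn M j.+1)|.
  by rewrite ltxx.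
apply: le_trans (norm_coords_le K_R_or_C _ j); rewrite linearB DE.
by rewrite -[X in _ <= `|X|]/(_ - trunc _ _ j) /trunc leq_maxr.
Qed.

Lemma trunc_weighted_le (x : nat -> E) C (c : nat -> nat) m :
  (forall m, seqnorm (X E) (trunc m x) <= C) ->
  {homo c : i j / (i <= j)%N} ->
  seqnorm (X E) (trunc m (fun j => (c j)%:R *: x j)) <= 2 * (c m)%:R * C.
Proof.
move=> xC cI; have [u uE] := coords_trunc x.
rewrite -(coords_weighted_sum (fun j => (c j)%:R) m uE) seqnorm_coords.
apply: (abel_bound_nondecr (w := fun j => (c j)%:R)) => j //.
  by rewrite -seqnorm_coords uE.
by rewrite ler_nat cI.
Qed.

End weights.

(** * Summing operators *)

Section main.
Variables (R : realType) (K : completeField).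
Hypothesis K_R_or_C : K = real_field R \/ K = complex_field R.

(** If the truncations of A(x) were unbounded, a slow weight v would turn the
    x k into members z k of the sequence spaces while keeping the contradiction
    visible: A(x) is A(z) times v^n, so its truncations grow at most like v^n,
    yet v is chosen so that they reach (v - 1)^(n+1). *)
Lemma summing_trunc_bounded (n : nat) (X : 'I_n -> seqClass K) (Y : seqClass K)
    (E : 'I_n -> completeNormedModType K) (F : completeNormedModType K)
    (A : (forall k, E k) -> F) (x : forall k, nat -> E k) :
  finitely_determined Y -> summing X Y E F A ->
  (forall k, exists C, forall m, seqnorm (X k (E k)) (trunc m (x k)) <= C) ->
  seqs (Y F) (induced A x).
Proof.
move=> Yfd [[Alin _] Asum] xbd; apply/finitely_determinedP => //.
set t := fun m => seqnorm (Y F) (trunc m (induced A x)).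
have [//|tunb] := pselect (exists C, forall m, t m <= C).
have [|v [vI vunb vslow]] := slow_weight (ltn0Sn n) _ tunb.
  by move=> m; exact: normr_ge0.
have v0 j : (0 < v j)%N by have [] := vslow j.
pose z k j : E k := (v j)%:R^-1 *: x k j.
have zX k : seqs (X k (E k)) (z k).
  by have [C xC] := xbd k; exact: (seqs_divided K_R_or_C xC v0 vI vunb).
have /finitely_determinedP[//|B zB] := Asum _ zX.
have B0 : 0 <= B by apply: le_trans (zB 0%N); exact: normr_ge0.
have xz : induced A x = fun j => (v j ^ n)%:R *: induced A z j.
  apply/funext => j; rewrite /induced /z multilinear_scale// scalerA.
  by rewrite natrX exprVn mulfV ?scale1r// expf_neq0// pnatr_eq0 -lt0n.
have expI i j : (i <= j)%N -> (i ^ n <= j ^ n)%N.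
  by case: (posnP n) => [->//|n0]; rewrite leq_exp2r.
have t_le m : t m <= 2 * (v m)%:R ^+ n * B.
  rewrite /t xz -natrX.
  apply: (@trunc_weighted_le _ _ _ _ _ (fun j => v j ^ n)%N) => //.
  by move=> i j ij; exact/expI/vI.
have [N NB] := scalar_le_nat K_R_or_C (mulr_ge0 (ler0n _ (2 ^ n.+1)) B0).
have [m Nm] := vunb N.+2; have [_ [j jm qj]] := vslow m.
set q := (v m).-1 in qj; have vq : v m = q.+1 by rewrite prednK.
have Nq : (N < q)%N by rewrite -ltnS -vq.
have q0 : 0 < q%:R :> K by rewrite ltr0n (leq_trans _ Nq).
suff /le_trans/(_ NB) : q%:R <= (2 ^ n.+1)%:R * B by rewrite ler_nat leqNgt Nq.
rewrite -(ler_pM2r (exprn_gt0 n q0)) -exprS (le_trans qj)//.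
rewrite (le_trans (t_le j))//.
(* v j <= v m = q + 1 <= 2 q turns the bound on t j into one in terms of q. *)
have -> : (2 ^ n.+1)%:R * B * q%:R ^+ n = 2 * ((2 * q) ^ n)%:R * B.
  by rewrite natrX exprS natrX natrM exprMn -!mulrA (mulrC B).
rewrite ler_wpM2r// ler_wpM2l// -natrX ler_nat expI// (leq_trans (vI _ _ jm))//.
by rewrite vq mul2n -addnn -addn1 leq_add2l (leq_ltn_trans _ Nq).
Qed.

End main.

Theorem theorem4p2 (R : realType) (K : completeField)
    (K_R_or_C : K = real_field R \/ K = complex_field R)
    (n : nat) (n_gt0 : (0 < n)%N) (X : 'I_n -> seqClass K)
    (X_stable : forall i, linearly_stable (X i))
    (X_dominated : jointly_dominated X)
    (Y : seqClass K) (Y_stable : linearly_stable Y)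
    (Y_findet : finitely_determined Y)
    (XY_ideal : ideal_condition X Y) :
  symmetric_summing X Y.
Proof.
move=> E F A Asum; split.
  exact: symmetrization_continuous_multilinear Asum.1.
move=> x xX; have [Z [_ Zfd XZ finZ]] := X_dominated.
have -> : induced (symmetrization A) x =
    (n`!%:R)^-1 *: \sum_(s : 'S_n) induced A (fun k => x (s k)).
  by apply/funext => j; rewrite /induced /symmetrization fctE fct_sumE.
apply/seqsZ/seqs_sum => s _.
apply: (summing_trunc_bounded K_R_or_C Y_findet Asum) => k.
have /finitely_determinedP[//|C xC] := (XZ (s k) E).1 _ (xX (s k)).
by exists C => m; apply: le_trans (xC m); apply: finZ; exact: c00_trunc.
Qed.
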